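(* Let $(\mathcal H,\theta)$ be as in the context, let $(B,\leq,\Psi)$ be a unitriangular basic set for $(\mathcal H,\theta)$, and let $\phi$ be an algebra automorphism of $\mathcal H$ with $\phi^2=\mathrm{Id}_{\mathcal H}$. Let $\Theta:B\to\Lambda$ be the injective map defined in the context, $\widetilde B=\Theta(B)$ and $\widetilde\Psi=\Psi\circ\Theta^{-1}:\widetilde B\to\operatorname{Irr}(L\mathcal H)$. For $\lambda\in\widetilde B$ let $\widetilde m(\lambda)$ be the element of $\widetilde B$ such that $\widetilde\Psi(\lambda)^\phi\simeq\widetilde\Psi(\widetilde m(\lambda))$. Then for all $\lambda\in\widetilde B$, $$\widetilde m(\lambda)=\begin{cases}\lambda&\text{if }\widetilde\Psi(\lambda)^\phi\simeq\widetilde\Psi(\lambda),\\ \lambda'&\text{otherwise.}\end{cases}$$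
   Context: Setting. $A$ is an integral domain, integrally closed in its field of fractions $K$; $\mathcal H$ is an associative symmetric $A$-algebra, finitely generated and free over $A$; $\theta:A\to L$ is a ring homomorphism to a field $L$ which is the field of fractions of $\theta(A)$; $K\mathcal H=K\otimes_A\mathcal H$ is split semisimple and $L\mathcal H=L\otimes_A\mathcal H$ ($L$ an $A$-module via $\theta$) is split. Write $\operatorname{Irr}(K\mathcal H)=\{V^\lambda\mid\lambda\in\Lambda\}$ (with the $V^\lambda$ pairwise non-isomorphic), and $\operatorname{Irr}(L\mathcal H)$ for the set of isomorphism classes of simple $L\mathcal H$-modules. The decomposition map $d_\theta:R_0(K\mathcal H)\to R_0(L\mathcal H)$ between Grothendieck groups of finite-dimensional modules is the additive map such that for each finite-dimensional $K\mathcal H$-module $V$ and each $h\in\mathcal H$, the characteristic polynomial of $h$ on $d_\theta([V])$ is obtained by applying $\theta$ to the coefficients of that of $h$ on $V$. The decomposition numbers are given by $d_\theta([V^\lambda])=\sum_{M\in\operatorname{Irr}(L\mathcal H)}d_{\lambda,M}[M]$. A unitriangular basic set for $(\mathcal H,\theta)$ is a triple $(B,\leq,\Psi)$ where $B\subset\Lambda$, $\leq$ is a total order on $\Lambda$ and $\Psi:B\to\operatorname{Irr}(L\mathcal H)$ is a bijection such that (1) $d_{\lambda,\Psi(\lambda)}=1$ for all $\lambda\in B$; (2) for all $M\in\operatorname{Irr}(L\mathcal H)$, $\lambda\in\Lambda$, $d_{\lambda,M}=0$ unless $\lambda\leq\Psi^{-1}(M)$. For a module $N$, $N^\phi$ is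 its twist by $\phi$ (same space, $h$ acts as $\phi(h)$). For $\lambda\in\Lambda$, $\lambda'\in\Lambda$ is defined by $(V^\lambda)^\phi\simeq V^{\lambda'}$; for $\lambda\in B$, $m(\lambda)\in B$ is defined by $\Psi(\lambda)^\phi\simeq\Psi(m(\lambda))$. The map $\Theta:B\to\Lambda$ is given by $\Theta(\lambda)=\lambda$ if $m(\lambda)\leq\lambda$ and $\Theta(\lambda)=m(\lambda)'$ if $m(\lambda)>\lambda$; it is injective. *)

(* Defs.v *)
From HB Require Import structures.
From mathcomp Require Import all_boot all_order all_algebra all_field.
From mathcomp Require Import boolp freeg.

Set Implicit Arguments.
Unset Strict Implicit.
Unset Printing Implicit Defensive.

Import GRing.Theory.
Import VectorInternalTheory.

Local Open Scope ring_scope.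

(* The scalar extension F (x)_A H along f : A -> F of an A-algebra H that is  *)
(* free of finite rank.  Writing (e_i) for the A-basis of H underlying its    *)
(* vectType structure, the element \sum_i x_i (x) e_i is represented by the   *)
(* row vector of its coordinates x_i, and the multiplication is the F-linear  *)
(* extension of that of H.                                                    *)

Section ScalarExtension.

Variables (A : comNzRingType) (F : fieldType).

Definition scalext (f : {rmorphism A -> F}) (H : falgType A) : Type :=
  'rV[F]_(dim H).

Variables (f : {rmorphism A -> F}) (H : falgType A).

HB.instance Definition _ := GRing.Lmodule.on (scalext f H).

(* 1 (x) h *)
Definition scalext_in (h : H) : scalext f H := map_mx f (v2r h).

Definition scalext_basis (i : 'I_(dim H)) : H := r2v (delta_mx 0 i).

Definition scalext_coef (x : scalext f H) (i : 'I_(dim H)) : F :=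
  (x : 'rV[F]_(dim H)) 0 i.

(* The F-linear extension of an A-linear map g : H -> H. *)
Definition scalext_lin (g : H -> H) (x : scalext f H) : scalext f H :=
  \sum_i scalext_coef x i *: scalext_in (g (scalext_basis i)).

Definition scalext_mul (x y : scalext f H) : scalext f H :=
  \sum_i \sum_j (scalext_coef x i * scalext_coef y j) *:
                scalext_in (scalext_basis i * scalext_basis j).

Lemma scalext_inD : {morph scalext_in : x y / x + y}.
Proof. by move=> x y; rewrite /scalext_in linearD map_mxD. Qed.

Lemma scalext_in0 : scalext_in 0 = 0.
Proof. by rewrite /scalext_in linear0 map_mx0. Qed.

Lemma scalext_in_sum I (r : seq I) (P : pred I) (E : I -> H) :
  scalext_in (\sum_(i <- r | P i) E i) = \sum_(i <- r | P i) scalext_in (E i).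
Proof. exact: (big_morph _ scalext_inD scalext_in0). Qed.

Lemma scalext_inZ a x : scalext_in (a *: x) = f a *: scalext_in x.
Proof. by rewrite /scalext_in linearZ /= map_mxZ. Qed.

Lemma scalext_decomp (h : H) : h = \sum_i v2r h 0 i *: scalext_basis i.
Proof.
rewrite -[LHS]v2rK [X in r2v X]row_sum_delta linear_sum /=.
by apply: eq_bigr => i _; rewrite linearZ.
Qed.

Lemma scalext_in_basis i : scalext_in (scalext_basis i) = delta_mx 0 i.
Proof. by rewrite /scalext_in /scalext_basis r2vK map_delta_mx. Qed.

Lemma scalext_expand (x : scalext f H) :
  x = \sum_i scalext_coef x i *: scalext_in (scalext_basis i).
Proof.
rewrite [LHS]row_sum_delta; apply: eq_bigr => i _.
by rewrite scalext_in_basis.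
Qed.

Lemma scalext_coefD x y i :
  scalext_coef (x + y) i = scalext_coef x i + scalext_coef y i.
Proof. by rewrite /scalext_coef mxE. Qed.

Lemma scalext_coefZ a x i : scalext_coef (a *: x) i = a * scalext_coef x i.
Proof. by rewrite /scalext_coef mxE. Qed.

Lemma scalext_coef_in h i : scalext_coef (scalext_in h) i = f (v2r h 0 i).
Proof. by rewrite /scalext_coef mxE. Qed.

Lemma scalext_lin_is_linear g : linear (scalext_lin g).
Proof.
move=> a x y; rewrite /scalext_lin scaler_sumr -big_split /=.
by apply: eq_bigr => i _; rewrite scalext_coefD scalext_coefZ scalerDl scalerA.
Qed.

HB.instance Definition _ g :=
  GRing.isLinear.Build F (scalext f H) (scalext f H) _ (scalext_lin g)
    (scalext_lin_is_linear g).

Lemma scalext_lin_in (g : {linear H -> H}) h :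
  scalext_lin g (scalext_in h) = scalext_in (g h).
Proof.
rewrite /scalext_lin [in RHS](scalext_decomp h) linear_sum scalext_in_sum.
by apply: eq_bigr => i _; rewrite linearZ /= scalext_inZ scalext_coef_in.
Qed.

Lemma scalext_mulDl : left_distributive scalext_mul +%R.
Proof.
move=> x y z; rewrite /scalext_mul -big_split; apply: eq_bigr => i _ /=.
rewrite -big_split; apply: eq_bigr => j _ /=.
by rewrite scalext_coefD mulrDl scalerDl.
Qed.

Lemma scalext_mulDr : right_distributive scalext_mul +%R.
Proof.
move=> x y z; rewrite /scalext_mul -big_split; apply: eq_bigr => i _ /=.
rewrite -big_split; apply: eq_bigr => j _ /=.
by rewrite scalext_coefD mulrDr scalerDl.
Qed.

Lemma scalext_mulZl a x y : scalext_mul (a *: x) y = a *: scalext_mul x y.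
Proof.
rewrite /scalext_mul scaler_sumr; apply: eq_bigr => i _.
rewrite scaler_sumr; apply: eq_bigr => j _.
by rewrite scalext_coefZ -mulrA scalerA.
Qed.

Lemma scalext_mulZr a x y : scalext_mul x (a *: y) = a *: scalext_mul x y.
Proof.
rewrite /scalext_mul scaler_sumr; apply: eq_bigr => i _.
rewrite scaler_sumr; apply: eq_bigr => j _.
by rewrite scalext_coefZ mulrCA scalerA.
Qed.

Lemma scalext_mul0l x : scalext_mul 0 x = 0.
Proof. by rewrite -[X in scalext_mul X _](scale0r 0) scalext_mulZl scale0r. Qed.

Lemma scalext_mul0r x : scalext_mul x 0 = 0.
Proof. by rewrite -[X in scalext_mul _ X](scale0r 0) scalext_mulZr scale0r. Qed.

Lemma scalext_mul_suml I (r : seq I) P (E : I -> scalext f H) y :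
  scalext_mul (\sum_(i <- r | P i) E i) y =
  \sum_(i <- r | P i) scalext_mul (E i) y.
Proof.
exact: (big_morph (scalext_mul^~ y) (fun u v => scalext_mulDl u v y)
          (scalext_mul0l y)).
Qed.

Lemma scalext_mul_sumr I (r : seq I) P (E : I -> scalext f H) x :
  scalext_mul x (\sum_(i <- r | P i) E i) =
  \sum_(i <- r | P i) scalext_mul x (E i).
Proof.
exact: (big_morph (scalext_mul x) (scalext_mulDr x) (scalext_mul0r x)).
Qed.

Lemma scalext_inM h k : scalext_mul (scalext_in h) (scalext_in k) =
  scalext_in (h * k).
Proof.
rewrite /scalext_mul [in RHS](scalext_decomp h) mulr_suml scalext_in_sum.
apply: eq_bigr => i _.
rewrite [in RHS](scalext_decomp k) mulr_sumr scalext_in_sum.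
apply: eq_bigr => j _.
rewrite !scalext_coef_in -scalerAl -scalerAr.
by rewrite !scalext_inZ scalerA.
Qed.

Lemma scalext_mulA : associative scalext_mul.
Proof.
move=> x y z; rewrite (scalext_expand x).
rewrite [X in _ = scalext_mul X z]scalext_mul_suml.
rewrite [LHS]scalext_mul_suml [RHS]scalext_mul_suml; apply: eq_bigr => i _.
rewrite [X in _ = scalext_mul X z]scalext_mulZl.
rewrite [LHS]scalext_mulZl [RHS]scalext_mulZl; congr (_ *: _).
rewrite (scalext_expand y) [X in scalext_mul _ X = _]scalext_mul_suml.
rewrite [X in _ = scalext_mul X z]scalext_mul_sumr.
rewrite [LHS]scalext_mul_sumr [RHS]scalext_mul_suml; apply: eq_bigr => j _.
rewrite [X in scalext_mul _ X = _]scalext_mulZl.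
rewrite [X in _ = scalext_mul X z]scalext_mulZr.
rewrite [LHS]scalext_mulZr [RHS]scalext_mulZl; congr (_ *: _).
rewrite (scalext_expand z) [X in scalext_mul _ X = _]scalext_mul_sumr.
rewrite [LHS]scalext_mul_sumr [RHS]scalext_mul_sumr; apply: eq_bigr => k _.
rewrite [X in scalext_mul _ X = _]scalext_mulZr.
rewrite [LHS]scalext_mulZr [RHS]scalext_mulZr; congr (_ *: _).
by rewrite !scalext_inM mulrA.
Qed.

Lemma scalext_mul1l : left_id (scalext_in 1) scalext_mul.
Proof.
move=> x; rewrite (scalext_expand x) scalext_mul_sumr.
by apply: eq_bigr => i _; rewrite scalext_mulZr scalext_inM mul1r.
Qed.

Lemma scalext_mul1r : right_id (scalext_in 1) scalext_mul.
Proof.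
move=> x; rewrite (scalext_expand x) scalext_mul_suml.
by apply: eq_bigr => i _; rewrite scalext_mulZl scalext_inM mulr1.
Qed.

Lemma scalext_1neq0 : scalext_in 1 != 0.
Proof.
apply/eqP => e0; suff: (1 : H) = 0 by apply/eqP; exact: oner_neq0.
rewrite (scalext_decomp 1); apply: big1 => i _; exfalso.
have := scalext_mul1l (scalext_in (scalext_basis i)).
rewrite e0 scalext_mul0l scalext_in_basis => /matrixP /(_ 0 i).
by rewrite !mxE !eqxx => /esym /eqP; rewrite oner_eq0.
Qed.

HB.instance Definition _ := GRing.Zmodule_isNzRing.Build (scalext f H)
  scalext_mulA scalext_mul1l scalext_mul1r scalext_mulDl scalext_mulDr
  scalext_1neq0.

HB.instance Definition _ := GRing.Lmodule_isLalgebra.Build F (scalext f H)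
  (fun a x y => esym (scalext_mulZl a x y)).

HB.instance Definition _ := GRing.Lalgebra_isAlgebra.Build F (scalext f H)
  (fun a x y => esym (scalext_mulZr a x y)).

Lemma scalext_lin_monoid (g : {lrmorphism H -> H}) :
  monoid_morphism (scalext_lin g).
Proof.
split; first by rewrite [1]/(scalext_in 1) scalext_lin_in rmorph1.
move=> x y; rewrite (scalext_expand x) mulr_suml !linear_sum /= mulr_suml.
apply: eq_bigr => i _; rewrite -scalerAl !linearZ /= -scalerAl; congr (_ *: _).
rewrite (scalext_expand y) mulr_sumr !linear_sum /= mulr_sumr.
apply: eq_bigr => j _; rewrite -scalerAr !linearZ /= -scalerAr; congr (_ *: _).
by rewrite !scalext_lin_in [_ * _]scalext_inM scalext_lin_in [RHS]scalext_inM
  rmorphM.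
Qed.

HB.instance Definition _ (g : {lrmorphism H -> H}) :=
  GRing.isMonoidMorphism.Build (scalext f H) (scalext f H) (scalext_lin g)
    (scalext_lin_monoid g).

End ScalarExtension.

Section Modules.

Variables (F : fieldType) (E : algType F).

(* A finite-dimensional left E-module: x in E acts on the space 'cV[F]_n of   *)
(* column vectors by v |-> mod_act x *m v.                                    *)
Record fdmod := FdMod {
  mod_dim : nat;
  mod_act : {lrmorphism E -> 'M[F]_mod_dim}
}.

HB.instance Definition _ := gen_eqMixin fdmod.
HB.instance Definition _ := gen_choiceMixin fdmod.

Implicit Types V W : fdmod.

Definition mod_hom V W (g : 'M[F]_(mod_dim W, mod_dim V)) : Prop :=
  forall x, g *m mod_act V x = mod_act W x *m g.

Definition mod_iso V W : Prop :=
  exists (g : 'M[F]_(mod_dim W, mod_dim V)) (g' : 'M[F]_(mod_dim V, mod_dim W)),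
    [/\ mod_hom g, g *m g' = 1%:M & g' *m g = 1%:M].

Definition submodule V (U : {vspace 'cV[F]_(mod_dim V)}) : Prop :=
  forall x v, v \in U -> mod_act V x *m v \in U.

Definition simple_mod V : Prop :=
  (0 < mod_dim V)%N /\
  forall U : {vspace 'cV[F]_(mod_dim V)}, submodule U ->
    U = 0%VS \/ U = fullv.

Definition semisimple_mod V : Prop :=
  forall U : {vspace 'cV[F]_(mod_dim V)}, submodule U ->
    exists U' : {vspace 'cV[F]_(mod_dim V)},
      [/\ submodule U', (U + U')%VS = fullv & (U :&: U')%VS = 0%VS].

Definition semisimple_alg : Prop := forall V, semisimple_mod V.

Definition split_alg : Prop :=
  forall V, simple_mod V ->
  forall g : 'M[F]_(mod_dim V), mod_hom (V := V) (W := V) g ->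
    exists a : F, g = a%:M.

(* (S i) is a family of representatives of the isomorphism classes of simple  *)
(* E-modules, so that I is identified with Irr(E).                            *)
Definition irr_family (I : finType) (S : I -> fdmod) : Prop :=
  [/\ forall i, simple_mod (S i),
      forall i j, mod_iso (S i) (S j) -> i = j
    & forall V, simple_mod V -> exists i, mod_iso V (S i)].

(* 0 -> V' -> V -> V'' -> 0 is exact for some maps *)
Definition short_exact V' V V'' : Prop :=
  exists (u : 'M[F]_(mod_dim V, mod_dim V')) (p : 'M[F]_(mod_dim V'', mod_dim V)),
    [/\ mod_hom u, mod_hom p,
        forall v : 'cV_(mod_dim V'), u *m v = 0 -> v = 0,
        forall w : 'cV_(mod_dim V''), exists v : 'cV_(mod_dim V), w = p *m v
      & forall v : 'cV_(mod_dim V),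
          p *m v = 0 <-> exists v' : 'cV_(mod_dim V'), v = u *m v'].

Inductive ses_span : {freeg fdmod / int} -> Prop :=
| Ses0 : ses_span 0
| SesB x y : ses_span x -> ses_span y -> ses_span (x - y)
| SesE V' V V'' : short_exact V' V V'' ->
    ses_span (<< V >> - << V' >> - << V'' >>).

Definition ses_rel : {pred {freeg fdmod / int}} := fun x => `[< ses_span x >].

Lemma ses_rel_zmod_closed : zmod_closed ses_rel.
Proof.
split; first by apply/asboolP; exact: Ses0.
by move=> x y /asboolP hx /asboolP hy; apply/asboolP; exact: SesB.
Qed.

HB.instance Definition _ :=
  GRing.isZmodClosed.Build {freeg fdmod / int} ses_rel ses_rel_zmod_closed.

(* The Grothendieck group R_0(E) of finite-dimensional E-modules. *)
Definition R0 : zmodType := Quotient.quot ses_rel.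

Definition R0_class V : R0 := \pi_(Quotient.quot ses_rel)%qT << V >>.

End Modules.

(* N^phi for a module N over F (x) H: 1 (x) h acts as 1 (x) phi(h). *)
Definition mod_twist (A : comNzRingType) (F : fieldType) (f : {rmorphism A -> F})
    (H : falgType A) (phi : {lrmorphism H -> H}) (N : fdmod (scalext f H)) :
    fdmod (scalext f H) :=
  FdMod (mod_act N \o scalext_lin phi).

(* Existence of a symmetrising form: a trace form tau such that the bilinear  *)
(* form (h, k) |-> tau (h * k) identifies H with its A-linear dual.           *)
Definition symmetric_alg (A : comNzRingType) (H : falgType A) : Prop :=
  exists tau : {linear H -> A^o},
    (forall h k, tau (h * k) = tau (k * h)) /\
    (forall g : {linear H -> A^o},
       exists! h, forall k, g k = tau (h * k)).

Definition integrally_closed (A : idomainType) : Prop :=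
  forall x : {fraction A}, integralOver (@tofrac A) x ->
    exists a : A, x = tofrac a.

Definition frac_of_image (A : idomainType) (L : fieldType)
    (theta : {rmorphism A -> L}) : Prop :=
  forall x : L, exists a b, theta b != 0 /\ x = theta a / theta b.

Section Decomposition.

Variables (A : idomainType) (L : fieldType) (theta : {rmorphism A -> L}).
Variable H : falgType A.

Definition KH : algType {fraction A} := scalext (@tofrac A) H.
Definition LH : algType L := scalext theta H.

(* The polynomial p over A is the characteristic polynomial of h on V, and    *)
(* its image under theta is that of h on any module W with [W] = d [V].       *)
Definition decomposition_map (d : {additive R0 KH -> R0 LH}) : Prop :=
  forall V : fdmod KH, exists2 W : fdmod LH, d (R0_class V) = R0_class W &
    forall h : H, exists2 p : {poly A},
      map_poly (@tofrac A) p = char_poly (mod_act V (scalext_in _ h)) &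
      map_poly theta p = char_poly (mod_act W (scalext_in _ h)).

Definition decomposition_numbers (d : {additive R0 KH -> R0 LH})
    (Lambda J : finType) (V : Lambda -> fdmod KH) (M : J -> fdmod LH)
    (dec : Lambda -> J -> int) : Prop :=
  forall l, d (R0_class (V l)) = \sum_j R0_class (M j) *~ dec l j.

End Decomposition.

(* Lambda and J index Irr(KH) and Irr(LH). *)
Record unitriangular_basic_set (Lambda J : finType)
    (dec : Lambda -> J -> int) := UnitriangularBasicSet {
  ubs_set : {set Lambda};
  ubs_le : rel Lambda;
  ubs_map : {l | l \in ubs_set} -> J;
  ubs_inv : J -> {l | l \in ubs_set};
  ubs_le_order : [/\ reflexive ubs_le, antisymmetric ubs_le,
                     transitive ubs_le & total ubs_le];
  ubs_mapK : cancel ubs_map ubs_inv;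
  ubs_invK : cancel ubs_inv ubs_map;
  ubs_diag : forall b, dec (val b) (ubs_map b) = 1;
  ubs_triangular : forall (M : J) (l : Lambda),
    ~~ ubs_le l (val (ubs_inv M)) -> dec l M = 0
}.

Section Theta.

Variables (Lambda J : finType) (dec : Lambda -> J -> int).
Variable B : unitriangular_basic_set dec.
(* l' and m(b) *)
Variable tw : Lambda -> Lambda.
Variable m : {l | l \in ubs_set B} -> {l | l \in ubs_set B}.

Definition Theta (b : {l | l \in ubs_set B}) : Lambda :=
  if ubs_le B (val (m b)) (val b) then val b else tw (val (m b)).

Definition Btilde : {set Lambda} := Theta @: [set: {l | l \in ubs_set B}].

Lemma Theta_onto (l : {l | l \in Btilde}) : exists b, Theta b == val l.
Proof. by case/imsetP: (valP l) => b _ ->; exists b. Qed.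

(* Theta is injective in the situation of interest, so that this section of  *)
(* Theta over its image is its inverse.                                       *)
Definition Theta_inv (l : {l | l \in Btilde}) : {l | l \in ubs_set B} :=
  xchoose (Theta_onto l).

Definition Psitilde (l : {l | l \in Btilde}) : J := ubs_map (Theta_inv l).

End Theta.

(* Main.v *)
Require Import Defs.
From mathcomp Require Import all_boot all_order all_algebra all_field.

Set Implicit Arguments.
Unset Strict Implicit.
Unset Printing Implicit Defensive.

Import GRing.Theory.

Local Open Scope ring_scope.

(** Write b = Theta^-1(l), so that Psitilde(l) = Psi(b).  Twisting by phi sends
Psi(b) to Psi(m(b)), hence Theta^-1 carries mt to m: if mt(l) = Theta(c), then
Psi(c) is isomorphic to Psi(m(b)), and c = m(b) because distinct members of an
irredundant family of simple modules are not isomorphic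
([Theta_inv_Btilde_twist]).  Thus mt(l) = Theta(m(b)), to be compared with
l = Theta(b).

If Psitilde(l) is phi-stable, then m(b) = b and mt(l) = l.  Otherwise b and m(b)
are two distinct elements exchanged by m, which is an involution since phi is.
Whichever is the larger for the total order, Theta fixes it and sends the
smaller one to its twist by phi.  The values of Theta on such an exchanged pair
are therefore x and x', where x is the larger element, and each is the twist of
the other as x'' = x ([Theta_swap]). *)

Section ModuleIsomorphism.

Variables (F : fieldType) (E : algType F).
Implicit Types U V W : fdmod E.

Lemma mod_iso_sym V W : mod_iso V W -> mod_iso W V.
Proof.
case=> g [g' [homg gg' g'g]]; exists g', g; split=> // x.
rewrite -[LHS]mulmx1 -gg' !mulmxA -(mulmxA g') -homg.
by rewrite mulmxA g'g mul1mx.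
Qed.

Lemma mod_iso_trans U V W : mod_iso U V -> mod_iso V W -> mod_iso U W.
Proof.
case=> g [g' [homg gg' g'g]] [k [k' [homk kk' k'k]]].
exists (k *m g), (g' *m k'); split=> [x||].
- by rewrite -mulmxA homg mulmxA homk mulmxA.
- by rewrite mulmxA -(mulmxA k) gg' mulmx1.
- by rewrite mulmxA -(mulmxA g') k'k mulmx1.
Qed.

Lemma eq_mod_act_iso (n : nat) (r s : {lrmorphism E -> 'M[F]_n}) :
  r =1 s -> mod_iso (FdMod r) (FdMod s).
Proof.
move=> eq_rs; exists 1%:M, 1%:M; split; rewrite ?mulmx1 // => x /=.
by rewrite mul1mx mulmx1 eq_rs.
Qed.

End ModuleIsomorphism.

Section Twist.

Variables (A : comNzRingType) (F : fieldType) (f : {rmorphism A -> F}).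
Variables (H : falgType A) (phi : {lrmorphism H -> H}).
Implicit Types V W : fdmod (scalext f H).

Lemma mod_twist_iso V W :
  mod_iso V W -> mod_iso (mod_twist phi V) (mod_twist phi W).
Proof.
case=> g [g' [homg gg' g'g]]; exists g, g'; split=> // x.
exact: homg (scalext_lin phi x).
Qed.

Hypothesis phiK : involutive phi.

Lemma scalext_linK : involutive (@scalext_lin A F f H phi).
Proof.
move=> x; rewrite [scalext_lin _ x]/scalext_lin linear_sum [RHS]scalext_expand.
apply: eq_bigr => i _; rewrite linearZ /= scalext_lin_in.
congr (_ *: scalext_in f _); exact: phiK.
Qed.

Lemma mod_twistK V : mod_iso (mod_twist phi (mod_twist phi V)) V.
Proof.
case: V => n r; apply: eq_mod_act_iso => x /=; congr (r _).
exact: scalext_linK.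
Qed.

Lemma twist_index_unique (I : finType) (S : I -> fdmod (scalext f H)) i j k :
  irr_family S ->
  mod_iso (mod_twist phi (S i)) (S j) -> mod_iso (mod_twist phi (S i)) (S k) ->
  j = k.
Proof.
case=> _ S_inj _ ij ik; apply: S_inj.
exact: mod_iso_trans (mod_iso_sym ij) ik.
Qed.

(** This makes involutions both of l |-> l' on Irr(KH) and of the action of phi on
Irr(LH), which m transports to the basic set. *)
Lemma twist_index_swap (I : finType) (S : I -> fdmod (scalext f H)) i j k :
  irr_family S ->
  mod_iso (mod_twist phi (S i)) (S j) -> mod_iso (mod_twist phi (S j)) (S k) ->
  k = i.
Proof.
case=> _ S_inj _ ij jk; apply: S_inj.
apply: mod_iso_trans (mod_iso_sym jk) _.
exact: mod_iso_trans (mod_twist_iso (mod_iso_sym ij)) (mod_twistK _).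
Qed.

End Twist.

Section ThetaTheory.

Variables (Lambda J : finType) (dec : Lambda -> J -> int).
Variable B : unitriangular_basic_set dec.
Variable tw : Lambda -> Lambda.
Variable m : {l | l \in ubs_set B} -> {l | l \in ubs_set B}.

Lemma Theta_invK (l : {l | l \in Btilde tw m}) :
  Theta tw m (Theta_inv l) = val l.
Proof. exact/eqP/(xchooseP (Theta_onto l)). Qed.

Lemma Theta_swap b :
  involutive tw -> involutive m -> m b <> b ->
  Theta tw m (m b) = tw (Theta tw m b).
Proof.
case: (ubs_le_order B) => _ le_anti _ le_total twK mK mb_neq.
rewrite /Theta mK; have := le_total (val b) (val (m b)).
case: ifP => le_bm; case: ifP => le_mb //= _.
(* When b and m(b) are strictly ordered, both sides agree up to tw (tw x) = x;
   what remains is that each is at most the other. *)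
case: mb_neq; apply/val_inj/le_anti.
by rewrite le_mb.
Qed.

End ThetaTheory.

(** Psi of either side is isomorphic to the twist by phi of Psi(b), for
b = Theta^-1(l), and Psi is injective. *)
Lemma Theta_inv_Btilde_twist (A : comNzRingType) (L : fieldType)
  (theta : {rmorphism A -> L}) (H : falgType A) (Lambda J : finType)
  (M : J -> fdmod (scalext theta H)) (dec : Lambda -> J -> int)
  (B : unitriangular_basic_set dec) (phi : {lrmorphism H -> H})
  (tw : Lambda -> Lambda)
  (m : {l | l \in ubs_set B} -> {l | l \in ubs_set B})
  (mt : {l | l \in Btilde tw m} -> {l | l \in Btilde tw m}) :
  irr_family M ->
  (forall b, mod_iso (mod_twist phi (M (ubs_map b))) (M (ubs_map (m b)))) ->
  (forall l,
     mod_iso (mod_twist phi (M (Psitilde l))) (M (Psitilde (mt l)))) ->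
  forall l, Theta_inv (mt l) = m (Theta_inv l).
Proof.
move=> hM hm hmt l; apply: (can_inj (@ubs_mapK _ _ _ B)).
exact: twist_index_unique hM (hmt l) (hm _).
Qed.

Theorem mainTheorem6
  (A : idomainType) (hA : integrally_closed A)
  (L : fieldType) (theta : {rmorphism A -> L}) (hL : frac_of_image theta)
  (H : falgType A) (hH : symmetric_alg H)
  (hKss : semisimple_alg (KH H)) (hKsplit : split_alg (KH H))
  (hLsplit : split_alg (LH theta H))
  (Lambda : finType) (V : Lambda -> fdmod (KH H)) (hV : irr_family V)
  (J : finType) (M : J -> fdmod (LH theta H)) (hM : irr_family M)
  (d : {additive R0 (KH H) -> R0 (LH theta H)}) (hd : decomposition_map d)
  (dec : Lambda -> J -> int) (hdec : decomposition_numbers d V M dec)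
  (B : unitriangular_basic_set dec)
  (phi : {lrmorphism H -> H}) (hphi : forall h, phi (phi h) = h)
  (tw : Lambda -> Lambda)
  (htw : forall l, mod_iso (mod_twist phi (V l)) (V (tw l)))
  (m : {l | l \in ubs_set B} -> {l | l \in ubs_set B})
  (hm : forall b, mod_iso (mod_twist phi (M (ubs_map b))) (M (ubs_map (m b))))
  (mt : {l | l \in Btilde tw m} -> {l | l \in Btilde tw m})
  (hmt : forall l,
     mod_iso (mod_twist phi (M (Psitilde l))) (M (Psitilde (mt l)))) :
  forall l : {l | l \in Btilde tw m},
    (mod_iso (mod_twist phi (M (Psitilde l))) (M (Psitilde l)) ->
       val (mt l) = val l) /\
    (~ mod_iso (mod_twist phi (M (Psitilde l))) (M (Psitilde l)) ->
       val (mt l) = tw (val l)).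
Proof.
have twK : involutive tw.
  by move=> l; apply: twist_index_swap hphi _ _ _ _ _ hV (htw l) (htw _).
have mK : involutive m.
  move=> b; apply: (can_inj (@ubs_mapK _ _ _ B)).
  exact: twist_index_swap hphi _ _ _ _ _ hM (hm b) (hm _).
move=> l; have mtE := Theta_inv_Btilde_twist hM hm hmt l.
rewrite -!Theta_invK mtE; split=> [stable | not_stable].
  congr (Theta tw m _); apply: (can_inj (@ubs_mapK _ _ _ B)).
  exact: twist_index_unique hM (hm _) stable.
apply: Theta_swap => // m_fix; apply: not_stable.
by rewrite /Psitilde -{2}m_fix; apply: hm.
Qed.
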